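(* Let $m\ge 2$ be an even integer, let $n\ge 1$ be an integer, and let $B_m^n=\{z\in\mathbb{C}^n : z_i^m=1\text{ for } i=1,\dots,n\}$. For any Hermitian $n\times n$ matrix $Q$ we have $$\max_{z\in B_m^n} z^*Qz=\max_{x\in\{-1,1\}^{nm/2}}\Bigl\{x^T\tilde Q x\ \text{ s.t. }\ \sum_{k=1}^{m/2-1}\bigl|x_{i(m/2)+k}-x_{i(m/2)+k+1}\bigr|\le 2,\ \ \forall\, 0\le i\le n-1\Bigr\},$$ where $\tilde Q\in\mathbb{R}^{nm/2\times nm/2}$ is defined as $\tilde Q=(I_n\otimes A)^TQ_R(I_n\otimes A)$, with $$Q_R=\begin{bmatrix}Q_R(1,1)&\dots&Q_R(1,n)\\ \vdots&\ddots&\vdots\\ Q_R(n,1)&\dots&Q_R(n,n)\end{bmatrix}\in\mathbb{R}^{2n\times 2n},\qquad Q_R(i,j)=\begin{bmatrix}\operatorname{Re}(Q_{ij})&-\operatorname{Im}(Q_{ij})\\ \operatorname{Im}(Q_{ij})&\operatorname{Re}(Q_{ij})\end{bmatrix}\in\mathbb{R}^{2\times 2},$$ $$A=\sin(\pi/m)\begin{bmatrix}\sin(\pi/m)&\sin(3\pi/m)&\dots&\sin((m-1)\pi/m)\\ -\cos(\pi/m)&-\cos(3\pi/m)&\dots&-\cos((m-1)\pi/m)\end{bmatrix}\in\mathbb{R}^{2\times m/2},$$ and $I_n\otimes A\in\mathbb{R}^{2n\times mn/2}$ is the block-diagonal matrix with $n$ diagonal blocks all equal to $A$.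
   Context: For $z\in\mathbb{C}^n$, $z^*$ is the conjugate transpose, so $z^*Qz=\sum_{i,j}Q_{ij}\overline{z_i}z_j$. The entries of $x\in\{-1,1\}^{nm/2}$ are indexed $x_1,\dots,x_{nm/2}$. *)

(* Defs.v *)
(* MathComp / MathComp-Analysis, with R[i] from mathcomp-real-closed. *)
From mathcomp Require Import all_boot all_order all_algebra.
From mathcomp Require Import complex mxtens.
From mathcomp Require Import classical_sets reals trigo.

Set Implicit Arguments.
Unset Strict Implicit.
Unset Printing Implicit Defensive.

Import Order.TTheory GRing.Theory Num.Theory.
Local Open Scope ring_scope.
Local Open Scope complex_scope.
Local Open Scope sesquilinear_scope.
Local Open Scope classical_set_scope.

(* The order of R[i] is partial (z <= w iff w - z is a nonnegative real), so
   a maximum of a set of complex numbers is comparable to all its members. *)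
Definition is_max d (T : porderType d) (S : set T) (M : T) : Prop :=
  S M /\ ubound S M.

Definition root_vectors (R : realType) (m n : nat) : set 'cV[R[i]]_n :=
  [set z | forall i, z i 0 ^+ m = 1].
Arguments root_vectors : clear implicits.

(* Conjugate-linear in the left occurrence of z. *)
Definition hermitian_form (R : realType) n (Q : 'M[R[i]]_n) (z : 'cV[R[i]]_n)
  : R[i] := (z ^t* *m Q *m z) 0 0.

Definition real_form (R : realType) N (Q : 'M[R]_N) (x : 'cV[R]_N) : R :=
  (x^T *m Q *m x) 0 0.

Definition realify (R : realType) (q : R[i]) : 'M[R]_2 :=
  block_mx (complex.Re q)%:M (- complex.Im q)%:M
           (complex.Im q)%:M (complex.Re q)%:M :> 'M[R]_(1 + 1).

(* [mxtens_unindex p] is the pair (p %/ 2, p %% 2) of block number and position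
   inside the block, the row and column numbering used by [*t]. *)
Definition realify_mx (R : realType) n (Q : 'M[R[i]]_n) : 'M[R]_(n * 2) :=
  \matrix_(p, q)
    realify (Q (mxtens_unindex p).1 (mxtens_unindex q).1)
            (mxtens_unindex p).2 (mxtens_unindex q).2.

(* Columns are indexed from 0, so column k carries the angle (2k + 1) pi / m. *)
Definition sign_to_root (R : realType) (m : nat) : 'M[R]_(2, m./2) :=
  sin (pi / m%:R) *:
    (col_mx (\row_(k < m./2) sin ((k.*2.+1)%:R * pi / m%:R))
            (\row_(k < m./2) - cos ((k.*2.+1)%:R * pi / m%:R))
       : 'M[R]_(1 + 1, m./2)).

Definition tildeQ (R : realType) (m n : nat) (Q : 'M[R[i]]_n)
    : 'M[R]_(n * m./2) :=
  let B : 'M[R]_(n * 2, n * m./2) := (1%:M : 'M[R]_n) *t sign_to_root R m in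
  B^T *m realify_mx Q *m B.

(* The entry x_k, counting from 1; the value 0 for k > N is never used below,
   nor is k = 0. *)
Definition entry (R : realType) N (x : 'cV[R]_N) (k : nat) : R :=
  if insub k.-1 is Some j then x j 0 else 0.

Definition sign_vectors (R : realType) (m n : nat) : set 'cV[R]_(n * m./2) :=
  [set x | forall j, x j 0 = 1 \/ x j 0 = -1].
Arguments sign_vectors : clear implicits.

Definition feasible (R : realType) (m n : nat) : set 'cV[R]_(n * m./2) :=
  [set x | sign_vectors R m n x /\
     forall i : nat, (i < n)%N ->
       \sum_(1 <= k < m./2)
         `|entry x (i * m./2 + k) - entry x (i * m./2 + k + 1)| <= 2].
Arguments feasible : clear implicits.

(* Main.v *)
Require Import Defs.
From mathcomp Require Import all_boot all_order all_algebra.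
From mathcomp Require Import complex mxtens ring lra zify.
From mathcomp Require Import classical_sets reals trigo.

Set Implicit Arguments.
Unset Strict Implicit.
Unset Printing Implicit Defensive.

Import Order.TTheory GRing.Theory Num.Theory.
Local Open Scope ring_scope.
Local Open Scope complex_scope.
Local Open Scope classical_set_scope.

(** Let w = exp (2 i pi / m) and h = m / 2, so that w^h = -1, and identify R^2
    with the complex plane.  The product formulas
      sin t sin ((2k+1) t) = (cos (2k t) - cos (2(k+1) t)) / 2,
      - sin t cos ((2k+1) t) = (sin (2k t) - sin (2(k+1) t)) / 2
    with t = pi / m say that the k-th column of A, counting from 0, is half of
    a chord, (w^k - w^(k+1)) / 2 ([sign_to_root_col]).  Hence A maps a sign
    vector s to
      sum_(0 <= k < h) s_k (w^k - w^(k+1)) / 2.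
    If s equals b before position j and - b from there on, this sum telescopes
    on both sides of j, and w^h = -1 makes the outer terms cancel: what remains
    is - b w^j ([sum_step_roots]).

    Each sign change costs exactly 2 in the total variation, so the constraint
    sum_k |s_k - s_(k+1)| <= 2 selects exactly the sign vectors with at most one
    change, that is, those of this form ([feasibleP]).  Since the m-th roots of
    unity are the numbers w^j and - w^j with 0 <= j < h, applying A to each of
    the n blocks maps the feasible set onto the vectors of m-th roots of unity
    ([decode_feasible]).

    The matrix Q_R is the real form of multiplication by Q, so x^T tildeQ x is
    the real part of z^* Q z for z the vector decoded from x, and for Hermitian
    Q this is z^* Q z itself ([real_form_decode]).  The two problems therefore
    have the same set of values.  It is finite and nonempty, because vectors of
    roots of unity are indexed by the functions from 'I_n to 'I_m, and so it
    has a maximum. *)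

(** * Quadratic forms in coordinates *)

Lemma Re_sum (R : realType) (I : Type) (r : seq I) (P : pred I) (F : I -> R[i]) :
  complex.Re (\sum_(i <- r | P i) F i) = \sum_(i <- r | P i) complex.Re (F i).
Proof. by apply: (big_morph (@complex.Re R)) => // -[a b] [c d]. Qed.

Lemma Im_sum (R : realType) (I : Type) (r : seq I) (P : pred I) (F : I -> R[i]) :
  complex.Im (\sum_(i <- r | P i) F i) = \sum_(i <- r | P i) complex.Im (F i).
Proof. by apply: (big_morph (@complex.Im R)) => // -[a b] [c d]. Qed.

Lemma hermitian_formE (R : realType) n (Q : 'M[R[i]]_n) z :
  hermitian_form Q z = \sum_i \sum_j (z i 0)^* * Q i j * z j 0.
Proof.
rewrite /hermitian_form mxE exchange_big /=; apply: eq_bigr => j _.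
rewrite mxE mulr_suml; apply: eq_bigr => i _.
by rewrite !mxE.
Qed.

Lemma real_formE (R : realType) n (Q : 'M[R]_n) y :
  real_form Q y = \sum_i \sum_j y i 0 * Q i j * y j 0.
Proof.
rewrite /real_form mxE exchange_big /=; apply: eq_bigr => j _.
rewrite mxE mulr_suml; apply: eq_bigr => i _.
by rewrite !mxE.
Qed.

Lemma big_mxtens (V : nmodType) n p (F : 'I_(n * p) -> V) :
  \sum_k F k = \sum_(i < n) \sum_(j < p) F (mxtens_index (i, j)).
Proof.
rewrite pair_big (reindex (@mxtens_index n p)) /=; last first.
  by exists (@mxtens_unindex n p) => k _; rewrite ?mxtens_indexK ?mxtens_unindexK.
by apply: eq_bigr => -[i j].
Qed.

(** * The real form of a Hermitian form *)

Definition complexify (R : realType) n (y : 'cV[R]_(n * 2)) : 'cV[R[i]]_n :=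
  \col_i (y (mxtens_index (i, 0)) 0 +i* y (mxtens_index (i, 1)) 0).

Lemma realifyE (R : realType) (q : R[i]) (a b : 'I_2) :
  realify q a b = if a == b then complex.Re q
                  else if a == 0 then - complex.Im q else complex.Im q.
Proof.
rewrite /realify /block_mx !mxE.
case: a => [[|[|//]] ha]; case: splitP => //= -[[|//] ?] // _; rewrite !mxE;
 case: b => [[|[|//]] hb]; case: splitP => //= -[[|//] ?] // _; by rewrite !mxE.
Qed.

Lemma realify_mxE (R : realType) n (Q : 'M[R[i]]_n) i j (a b : 'I_2) :
  realify_mx Q (mxtens_index (i, a)) (mxtens_index (j, b)) =
  if a == b then complex.Re (Q i j)
  else if a == 0 then - complex.Im (Q i j) else complex.Im (Q i j).
Proof. by rewrite -realifyE [LHS]mxE !mxtens_indexK. Qed.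

(** The block [realify q] is the matrix of multiplication by q on the plane,
    and the scalar product of the plane is the real part of u^* v. *)
Lemma real_form_realify (R : realType) n (Q : 'M[R[i]]_n) (y : 'cV[R]_(n * 2)) :
  real_form (realify_mx Q) y = complex.Re (hermitian_form Q (complexify y)).
Proof.
rewrite real_formE hermitian_formE big_mxtens Re_sum; apply: eq_bigr => i _.
under eq_bigr do rewrite big_mxtens.
rewrite exchange_big Re_sum; apply: eq_bigr => j _ /=.
rewrite !big_ord_recl !big_ord0 !realify_mxE !mxE /=.
have -> : lift ord0 ord0 = 1 :> 'I_2 by apply: val_inj.
case: (Q i j) => a b /=; ring.
Qed.

Lemma hermitian_form_real (R : realType) n (Q : 'M[R[i]]_n) z :
  Q \is hermsymmx -> hermitian_form Q z = (complex.Re (hermitian_form Q z))%:C.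
Proof.
move=> /is_hermitianmxP; rewrite expr0 scale1r => hQ.
have Qc i j : (Q i j)^* = Q j i.
  by rewrite [in LHS]hQ !mxE; apply: conjcK.
have : (hermitian_form Q z)^* = hermitian_form Q z.
  rewrite hermitian_formE rmorph_sum exchange_big; apply: eq_bigr => i _ /=.
  rewrite rmorph_sum; apply: eq_bigr => j _ /=.
  rewrite !rmorphM /= conjcK Qc; ring.
case: (hermitian_form Q z) => a b [] /= hb; congr (_ +i* _); lra.
Qed.

(** * Roots of unity as a sum of half chords *)

Definition expi (R : realType) (a : R) : R[i] := cos a +i* sin a.

Lemma expiX (R : realType) (a : R) k : expi a ^+ k = expi (k%:R * a).
Proof.
elim: k => [|k IHk]; first by rewrite expr0 mul0r /expi cos0 sin0.
rewrite exprS IHk mulrS mulrDl mul1r /expi cosD sinD; simpc.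
by congr (_ +i* _); ring.
Qed.

Definition unity_root (R : realType) m : R[i] := expi (2 * (pi / m%:R)).

Lemma prim_unity_root (R : realType) m : (0 < m)%N ->
  m.-primitive_root (unity_root R m).
Proof.
move=> m_gt0; rewrite /primitive_root_of_unity m_gt0; apply/forallP => /= k.
have mR : 0 < m%:R :> R by rewrite ltr0n.
rewrite unity_rootE expiX; apply/eqP; case: (eqVneq k.+1 m) => [->|km].
  rewrite mulrCA [m%:R * _]mulrCA (divff (lt0r_neq0 mR)) mulr1 mulr_natl.
  by rewrite /expi cos2pi sin2pi eqxx.
apply/negbTE/eqP => -[].
have -> : k.+1%:R * (2 * (pi / m%:R)) = (k.+1%:R * (pi / m%:R)) *+ 2 :> R.
  by ring.
set a := _ * _ => h _.
have : 0 < sin a.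
  apply: sin_gt0_pi; rewrite /a mulr_gt0 ?divr_gt0 ?pi_gt0 ?ltr0n//=.
  rewrite mulrCA gtr_pMr ?pi_gt0// ltr_pdivrMr// mul1r ltr_nat.
  by rewrite ltn_neqAle km /= ltn_ord.
(* cos (2 a) = 1 forces sin a = 0, but 0 < a < pi. *)
move: h; rewrite cos_mulr2n cos2sin2 => h s0; nra.
Qed.

Lemma half_unity_root (R : realType) m : (0 < m)%N -> ~~ odd m ->
  unity_root R m ^+ m./2 = -1.
Proof.
move=> m_gt0 /negbTE m_even; rewrite expiX.
have -> : (m./2)%:R * (2 * (pi / m%:R)) = pi :> R.
  rewrite mulrA -natrM muln2.
  have -> : m./2.*2 = m by rewrite -[RHS]odd_double_half m_even.
  by rewrite mulrCA divff ?mulr1// pnatr_eq0 -lt0n.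
by rewrite /expi cospi sinpi; apply/eqP; rewrite eq_complex /= oppr0 !eqxx.
Qed.

(** With t = pi / m, the column is sin t * (- i) * exp (i (2k+1) t), and
    - i * sin t = - (exp (i t) - exp (- i t)) / 2; the product is half of the
    chord from w^(k+1) to w^k. *)
Lemma sign_to_root_col (R : realType) m (k : 'I_m./2) :
  sign_to_root R m 0 k +i* sign_to_root R m 1 k =
  (unity_root R m ^+ k - unity_root R m ^+ k.+1) / 2.
Proof.
set t : R := pi / m%:R.
have -> : sign_to_root R m 0 k = sin t * sin (k.*2.+1%:R * t).
  rewrite /sign_to_root mxE -/t /col_mx mxE; case: splitP => //= j _.
  by rewrite mxE mulrA.
have -> : sign_to_root R m 1 k = - (sin t * cos (k.*2.+1%:R * t)).
  rewrite /sign_to_root mxE -/t /col_mx mxE; case: splitP => /= [[[]]|] // j _.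
  by rewrite mxE mulrN mulrA.
rewrite !expiX -/t.
have -> : k%:R * (2 * t) = k.*2.+1%:R * t - t.
  by rewrite -[k.*2.+1]addn1 natrD -[k.*2]muln2 natrM; ring.
have -> : k.+1%:R * (2 * t) = k.*2.+1%:R * t + t.
  by rewrite -[k.+1]addn1 -[k.*2.+1]addn1 !natrD -[k.*2]muln2 natrM; ring.
apply: (canRL (mulfK _)); first by rewrite pnatr_eq0.
rewrite /expi cosB cosD sinB sinD [2]mulr2n mulrDr mulr1; simpc.
by congr (_ +i* _); ring.
Qed.

Definition decode (R : realType) m n (x : 'cV[R]_(n * m./2)) : 'cV[R[i]]_n :=
  complexify ((1%:M *t sign_to_root R m) *m x).

Lemma decodeE (R : realType) m n (x : 'cV[R]_(n * m./2)) (i : 'I_n) :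
  decode x i 0 =
  \sum_(k < m./2) (x (mxtens_index (i, k)) 0)%:C
     * ((unity_root R m ^+ k - unity_root R m ^+ k.+1) / 2).
Proof.
have row a : ((1%:M *t sign_to_root R m) *m x) (mxtens_index (i, a)) 0 =
    \sum_(k < m./2) sign_to_root R m a k * x (mxtens_index (i, k)) 0.
  rewrite mxE big_mxtens (bigD1 i) //= [X in _ + X]big1 ?addr0.
    by apply: eq_bigr => k _; rewrite mxE !mxtens_indexK /= mxE eqxx mul1r.
  move=> j ji; apply: big1 => k _; rewrite mxE !mxtens_indexK /= mxE.
  by rewrite eq_sym (negbTE ji) !mul0r.
rewrite mxE !row; apply/eqP; rewrite eq_complex /= Re_sum Im_sum.
by apply/andP; split; apply/eqP/eq_bigr => k _; rewrite -sign_to_root_col /=; ring.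
Qed.

Lemma real_form_decode (R : realType) m n (Q : 'M[R[i]]_n) (x : 'cV[R]_(n * m./2)) :
  Q \is hermsymmx -> (real_form (tildeQ m Q) x)%:C = hermitian_form Q (decode x).
Proof.
move=> hQ; rewrite hermitian_form_real // -real_form_realify; congr _%:C.
by rewrite /real_form /tildeQ trmx_mul !mulmxA.
Qed.

(** * Sign sequences of total variation at most 2 *)

Definition is_sign (R : realType) (b : R) : Prop := b = 1 \/ b = -1.

(** The constant sequences are included, as the cases where no k or every k
    under consideration is below j. *)
Definition step (R : realType) (b : R) (j k : nat) : R :=
  if (k < j)%N then b else - b.

Lemma is_sign_step (R : realType) (b : R) j k :
  is_sign b -> is_sign (step b j k).
Proof. by rewrite /is_sign /step; case: ifP => _ [->|->]; rewrite ?opprK; auto. Qed.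

(** Multiplied by b, a step sequence is nonincreasing, so its
    total variation telescopes to the difference of its end values. *)
Lemma variation_step (R : realType) (b : R) j p : is_sign b ->
  \sum_(0 <= k < p) `|step b j k - step b j k.+1| <= 2.
Proof.
move=> hb.
have termE k : `|step b j k - step b j k.+1| =
    - (b * step b j k.+1) - - (b * step b j k).
  rewrite /step; case: hb => ->; case: (ltnP k j); case: (ltnP k.+1 j) => //;
  try lia; move=> _ _; rewrite ?subrr ?normr0 ?opprK; try ring.
  - by rewrite ger0_norm; [ring | lra].
  - by rewrite ler0_norm; [ring | lra].
rewrite (eq_bigr _ (fun k _ => termE k)) telescope_sumr //.
by case: hb => hb; rewrite /step hb; case: ifP; case: ifP => _ _; lra.
Qed.

Lemma dist_le_variation (R : realType) (s : nat -> R) a b : (a <= b)%N ->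
  `|s a - s b| <= \sum_(a <= k < b) `|s k - s k.+1|.
Proof.
move=> ab; rewrite distrC -telescope_sumr //; apply: le_trans (ler_norm_sum _ _ _) _.
by apply: ler_sum => k _; rewrite distrC.
Qed.

(** Let j be the first position at which s differs from s 0, or h if there is
    none.  A later position k with s k = s 0 would give a variation of at least
    |s 0 - s j| + |s j - s k| = 4. *)
Lemma step_of_variation_le2 (R : realType) (s : nat -> R) h :
    (forall k, (k < h)%N -> is_sign (s k)) ->
    \sum_(0 <= k < h.-1) `|s k - s k.+1| <= 2 ->
  exists2 j, (j <= h)%N & forall k, (k < h)%N -> s k = step (s 0) j k.
Proof.
move=> s_sign var_le2; pose P k := s k != s 0%N.
exists (find P (iota 0 h)).
  by rewrite -[X in (_ <= X)%N](size_iota 0 h) find_size.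
move=> k kh; rewrite /step; case: ltnP => [kj | jk].
  by have := before_find 0%N kj; rewrite nth_iota // add0n => /negbFE /eqP.
have jh := leq_ltn_trans jk kh.
have := jh; rewrite -[X in (_ < X)%N](size_iota 0 h) -has_find.
move=> /(nth_find 0%N); rewrite nth_iota // add0n.
move: (find _ _) jk jh => j jk jh /eqP sj.
have le0k : `|s 0%N - s j| + `|s j - s k| <= 2.
  apply: le_trans var_le2.
  apply: le_trans (lerD (dist_le_variation s (leq0n j)) (dist_le_variation s jk)) _.
  have kh1 : (k <= h.-1)%N by lia.
  rewrite -big_cat_nat //= [leRHS](big_cat_nat (leq0n k) kh1) /=.
  by rewrite lerDl sumr_ge0.
have s0 := s_sign 0%N (leq_ltn_trans (leq0n _) jh).
have n2 : `|1 - -1| = 2 :> R by rewrite opprK ger0_norm // addr_ge0.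
have n2' : `|-1 - 1| = 2 :> R by rewrite distrC n2.
case: (s_sign _ jh) (s_sign _ kh) s0 sj le0k => [->|->] [->|->] [->|->] //;
  by rewrite ?n2 ?n2' ?opprK // => _ ?; exfalso; lra.
Qed.

(** The two telescoping sums give b (1 - w^j) / 2 and - b (w^j - w^h) / 2; since
    w^h = -1, the constants cancel. *)
Lemma sum_step_roots (R : realType) (w : R[i]) (b : R) h j :
    w ^+ h = -1 -> (j <= h)%N ->
  \sum_(k < h) (step b j k)%:C * ((w ^+ k - w ^+ k.+1) / 2) = - b%:C * w ^+ j.
Proof.
move=> wh jh; rewrite -(big_mkord predT
  (fun k => (step b j k)%:C * ((w ^+ k - w ^+ k.+1) / 2))).
rewrite (big_cat_nat (leq0n j) jh) /=.
under eq_big_nat => k /andP[_ kj].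
  have -> : (step b j k)%:C * ((w ^+ k - w ^+ k.+1) / 2) =
     - (b%:C * w ^+ k.+1 / 2) - - (b%:C * w ^+ k / 2) by rewrite /step kj; ring.
  over.
under [X in _ + X]eq_big_nat => k /andP[jk _].
  have -> : (step b j k)%:C * ((w ^+ k - w ^+ k.+1) / 2) =
     (b%:C * w ^+ k.+1 / 2) - (b%:C * w ^+ k / 2).
    by rewrite /step ltnNge jk /= rmorphN /=; ring.
  over.
by rewrite !telescope_sumr // wh expr0; field.
Qed.

(** * The feasible set *)

Lemma entry_block (R : realType) h n (x : 'cV[R]_(n * h)) (i : 'I_n) (k : 'I_h) :
  entry x (i * h + k).+1 = x (mxtens_index (i, k)) 0.
Proof.
rewrite /entry /=; case: insubP => [p _ pE | /negP[]]; last first.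
  exact: (ltn_ord (mxtens_index (i, k))).
by congr (x _ 0); apply: val_inj.
Qed.

Lemma feasibleP (R : realType) m n (x : 'cV[R]_(n * m./2)) :
  feasible R m n x <->
  forall i : 'I_n, exists (b : R) (j : nat),
    [/\ is_sign b, (j <= m./2)%N
      & forall k : 'I_m./2, x (mxtens_index (i, k)) 0 = step b j k].
Proof.
have variationE (i : nat) :
    \sum_(1 <= k < m./2) `|entry x (i * m./2 + k) - entry x (i * m./2 + k + 1)|
  = \sum_(0 <= k < m./2.-1)
      `|entry x (i * m./2 + k).+1 - entry x (i * m./2 + k.+1).+1|.
  by rewrite big_add1; apply: eq_bigr => k _; rewrite addn1 !addnS.
split=> [[x_sign x_var] i | x_step].
  have [m0 | m_gt0] := posnP m./2.
    exists 1, 0%N; split=> //; first by left.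
    by move=> k; have := ltn_ord k; rewrite [X in (_ < X)%N]m0.
  pose s k := entry x (i * m./2 + k).+1.
  have s_sign k : (k < m./2)%N -> is_sign (s k).
    by move=> km; rewrite /s (entry_block x i (Ordinal km)); apply: x_sign.
  have [|j jm sE] := @step_of_variation_le2 _ s m./2 s_sign.
    by have := x_var i (ltn_ord i); rewrite variationE.
  exists (s 0%N), j; split; [exact: s_sign | by [] | move=> k].
  by rewrite -sE // /s entry_block.
split=> [p | i ni].
  case: (mxtens_indexP p) => i k; have [b [j [hb _ ->]]] := x_step i.
  exact: is_sign_step.
have [b [j [hb _ xE]]] := x_step (Ordinal ni).
rewrite variationE; apply: le_trans (variation_step j m./2.-1 hb).
apply: ler_sum_nat => k /andP[_ km].
have km0 : (k < m./2)%N by lia.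
have km1 : (k.+1 < m./2)%N by lia.
have /= -> := entry_block x (Ordinal ni) (Ordinal km0).
have /= -> := entry_block x (Ordinal ni) (Ordinal km1).
by rewrite !xE.
Qed.

Lemma decode_step (R : realType) m n (x : 'cV[R]_(n * m./2)) (i : 'I_n) b j :
    (0 < m)%N -> ~~ odd m -> (j <= m./2)%N ->
    (forall k : 'I_m./2, x (mxtens_index (i, k)) 0 = step b j k) ->
  decode x i 0 = - b%:C * unity_root R m ^+ j.
Proof.
move=> m_gt0 m_even jm xE; rewrite decodeE.
by under eq_bigr do rewrite xE; rewrite sum_step_roots // half_unity_root.
Qed.

Lemma root_vectorsP (R : realType) m n (w : R[i]) (z : 'cV[R[i]]_n) :
    m.-primitive_root w ->
  root_vectors R m n z <-> exists t : {ffun 'I_n -> 'I_m}, z = \col_i w ^+ t i.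
Proof.
move=> w_prim; split=> [z_root | [t ->] i].
  exists [ffun i => sval (prim_rootP w_prim (z_root i))].
  by apply/colP => i; rewrite mxE ffunE; case: prim_rootP.
by rewrite mxE exprAC (prim_expr_order w_prim) expr1n.
Qed.

(** As w^(m / 2) = -1, the powers of w from the exponent m / 2 on are the
    opposites of the first m / 2 ones, so that the numbers - b w^j reached by
    [decode_step] exhaust the m-th roots of unity.  None of them lies outside,
    because m is even and therefore (- b)^m = 1. *)
Lemma decode_feasible (R : realType) m n : (0 < m)%N -> ~~ odd m ->
  (@decode R m n) @` feasible R m n = root_vectors R m n.
Proof.
move=> m_gt0 m_even; have w_prim := prim_unity_root R m_gt0.
have m2 : m = (2 * m./2)%N.
  by have := odd_double_half m; rewrite (negbTE m_even); lia.
apply/seteqP; split=> [_ [x /feasibleP x_step <-] i | z].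
  have [b [j [hb jm xE]]] := x_step i.
  rewrite (decode_step m_gt0 m_even jm xE) exprMn exprAC.
  rewrite (prim_expr_order w_prim) expr1n mulr1.
  rewrite m2 exprM sqrrN; suff -> : b%:C ^+ 2 = 1 by rewrite expr1n.
  by rewrite -rmorphXn /=; case: hb => ->; rewrite ?sqrrN expr1n.
move=> /(root_vectorsP _ w_prim)[t ->].
(* w^t = - b w^j with b = -1 and j = t for t < m / 2; beyond that, b = 1 and
   j = t - m / 2, since w^(m / 2) = -1. *)
pose b i : R := if (t i < m./2)%N then -1 else 1.
pose j i := if (t i < m./2)%N then t i : nat else (t i - m./2)%N.
have b_sign i : is_sign (b i) by rewrite /b; case: ifP => _; [right | left].
have jm i : (j i <= m./2)%N.
  by rewrite /j; case: ltnP; have := ltn_ord (t i); lia.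
pose x : 'cV[R]_(n * m./2) := \col_p
  step (b (mxtens_unindex p).1) (j (mxtens_unindex p).1) (mxtens_unindex p).2.
have xE i (k : 'I_m./2) : x (mxtens_index (i, k)) 0 = step (b i) (j i) k.
  by rewrite mxE mxtens_indexK.
exists x; first by apply/feasibleP => i; exists (b i), (j i).
apply/colP => i; rewrite (decode_step m_gt0 m_even (jm i) (xE i)) mxE /b /j.
case: ltnP => [_ | mt]; first by rewrite rmorphN rmorph1 opprK mul1r.
by rewrite rmorph1 -(half_unity_root R m_gt0 m_even) -exprD subnKC.
Qed.

(** * Equality of the maxima *)

Theorem theorem5 (R : realType) (m n : nat) (Q : 'M[R[i]]_n)
    (hm : (2 <= m)%N) (hm_even : ~~ odd m) (hn : (1 <= n)%N)
    (hQ : Q \is hermsymmx) :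
  exists M : R,
    is_max [set hermitian_form Q z | z in root_vectors R m n] M%:C /\
    is_max [set real_form (tildeQ m Q) x | x in feasible R m n] M.
Proof.
have m_gt0 : (0 < m)%N := ltnW hm.
have w_prim := prim_unity_root R m_gt0.
pose z (t : {ffun 'I_n -> 'I_m}) := \col_i unity_root R m ^+ t i.
pose f t := complex.Re (hermitian_form Q (z t)).
have formE t : hermitian_form Q (z t) = (f t)%:C by exact: hermitian_form_real.
have [t0 t0_max] : exists t0, forall t, f t <= f t0.
  exists [arg max_(t > [ffun=> Ordinal m_gt0] | true) f t]%O.
  by case: arg_maxP => // t0 _ t0_max t; apply: t0_max.
have z0_root : root_vectors R m n (z t0).
  by apply/(root_vectorsP _ w_prim); exists t0.
exists (f t0); split; split.
- by exists (z t0).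
- by move=> _ [_ /(root_vectorsP _ w_prim)[t ->] <-]; rewrite -/(z t) formE lecR.
- move: z0_root; rewrite -decode_feasible // => -[x x_feas xE].
  by exists x => //; apply: complexI; rewrite real_form_decode // xE.
- move=> _ [x x_feas <-]; rewrite -lecR real_form_decode //.
  have : root_vectors R m n (decode x) by rewrite -decode_feasible //; exists x.
  by move=> /(root_vectorsP _ w_prim)[t ->]; rewrite -/(z t) formE lecR.
Qed.
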